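(* Let $X_1,\dots,X_n\in\mathbb{R}^p$ and $Y_1,\dots,Y_n\in\mathbb{R}^p$ be random vectors satisfying the standing assumptions listed in the context; in particular $X_i$ and $Y_i$ have mean $0$ and $\mathrm{cov}(X_i)=\mathrm{cov}(Y_i)$ for each $i$. Let $R_1,\dots,R_n$ be deterministic and let $A$ be a deterministic positive semidefinite $p\times p$ matrix. For $z\in\mathbb{C}$ with $\mathrm{Im}(z)=v>0$ let $$m_{p,X}(z)=\frac1p\,\mathrm{trace}\left(\Big(\frac1n\sum_{i=1}^nR_i^2X_iX_i^\top+A-z\,\mathrm{Id}\Big)^{-1}\right),$$ and define $m_{p,Y}(z)$ in the same way with the $Y_i$ in place of the $X_i$. Then, for any fixed such $z$ and a numerical constant $K$, $$\left|\mathbb{E}[m_{p,X}(z)-m_{p,Y}(z)]\right|\le\frac1p\sum_{i=1}^n\left(\frac{K|z|}{v^3}\frac{R_i^2}{n}\left[b_{Q_2}(1;X_i)+b_{Q_2}(1;Y_i)\right]\right)\wedge\frac2v .$$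
   Context: $a\wedge b=\min(a,b)$; in the sum, the minimum with $2/v$ is taken in each summand. $\|\cdot\|_{op}$ is the operator norm. Standing assumptions: the ratio $p/n$ stays bounded away from $0$ and $\infty$; the $X_j$ are independent, the $Y_j$ are independent, and the $Y_j$'s are independent of the $X_j$'s; for each $j$, $X_j$ and $Y_j$ have mean $0$ and the same covariance matrix $\Sigma_j$. For $Z\in\{X_j,Y_j\}$, $b_{Q_2}(1;Z)$ is a finite deterministic number such that $\mathbb{E}|Z^\top MZ-\mathbb{E}[Z^\top MZ]|\le b_{Q_2}(1;Z)$ for every deterministic positive semidefinite $M$ with $\|M\|_{op}\le1$. *)

(* Defs.v *)
From HB Require Import structures.
From mathcomp Require Import all_boot all_order all_algebra.
From mathcomp Require Import all_classical all_reals all_analysis.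
From mathcomp Require Import complex.

Set Implicit Arguments.
Unset Strict Implicit.
Unset Printing Implicit Defensive.

Import Order.TTheory GRing.Theory Num.Theory.
Import numFieldNormedType.Exports.

Local Open Scope classical_set_scope.
Local Open Scope ring_scope.

Section Matrices.
Context {R : realType} {p : nat}.
Implicit Types (M : 'M[R]_p) (x : 'cV[R]_p).

Definition qform M x : R := (x^T *m M *m x) 0 0.

Definition psd M : Prop := M^T = M /\ forall x, 0 <= qform M x.

Definition l2norm x : R := Num.sqrt (\sum_(k < p) x k 0 ^+ 2).

Definition op_norm M : R :=
  sup [set l2norm (M *m x) | x in [set x | l2norm x <= 1]].

End Matrices.

Section RandomVectors.
Context {d : measure_display} {T : measurableType d} {R : realType}.
Context (P : probability T R) {p : nat}.
Implicit Types Z : T -> 'cV[R]_p.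

Definition coor Z (k : 'I_p) : T -> R := fun w => Z w k 0.

(* Membership in [Lfun P 2] includes measurability of the coordinates. *)
Definition square_integrable Z : Prop :=
  forall k : 'I_p, coor Z k \in Lfun P 2%:E.

Definition mean_vec Z : 'cV[R]_p :=
  \col_k fine 'E_P[coor Z k].

Definition cov_mx Z : 'M[R]_p :=
  \matrix_(k, l) fine (covariance P (coor Z k) (coor Z l)).

(* [quad_conc_bound Z b] says that b is an admissible value of b_{Q_2}(1; Z). *)
Definition quad_conc_bound Z (b : R) : Prop :=
  forall M : 'M[R]_p, psd M -> op_norm M <= 1 ->
  ('E_P[fun w => `| qform M (Z w) - fine 'E_P[fun w' => qform M (Z w')] |%R]
     <= b%:E)%E.

Definition sigma_rvec Z : set (set T) :=
  g_sigma_preimage (coor Z).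

Definition sigma_rvecs n (Z : 'I_n -> T -> 'cV[R]_p) : set (set T) :=
  <<s \bigcup_(i in [set: 'I_n]) sigma_rvec (Z i) >>.

Definition independent_rvecs n (Z : 'I_n -> T -> 'cV[R]_p) : Prop :=
  forall (J : {set 'I_n}) (E : 'I_n -> set T),
  (forall j, j \in J -> sigma_rvec (Z j) (E j)) ->
  P (\bigcap_(j in [set` J]) E j) = (\prod_(j in J) P (E j))%E.

Definition independent_families n (Z Z' : 'I_n -> T -> 'cV[R]_p) : Prop :=
  forall E E' : set T, sigma_rvecs Z E -> sigma_rvecs Z' E' ->
  P (E `&` E') = (P E * P E')%E.

Definition expectationC (f : T -> R[i]) : R[i] :=
  Complex (fine 'E_P[fun w => complex.Re (f w)])
          (fine 'E_P[fun w => complex.Im (f w)]).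

End RandomVectors.

Definition scatter_mx {R : realType} {n p : nat} (r : 'I_n -> R)
    (x : 'I_n -> 'cV[R]_p) : 'M[R]_p :=
  n%:R^-1 *: \sum_(i < n) r i ^+ 2 *: (x i *m (x i)^T).

(* The matrix inverted here is always invertible when the first argument [S]
   is symmetric and 'Im z > 0. *)
Definition stieltjes {R : realType} {p : nat} (S : 'M[R]_p) (z : R[i]) : R[i] :=
  p%:R^-1 * \tr (invmx (map_mx (real_complex R) S - z%:M)).

Definition mp {R : realType} {n p : nat} {T : Type} (r : 'I_n -> R)
    (A : 'M[R]_p) (Z : 'I_n -> T -> 'cV[R]_p) (z : R[i]) (w : T) : R[i] :=
  stieltjes (scatter_mx r (fun i => Z i w) + A) z.

(* Main.v *)
From HB Require Import structures.
Require Import Defs.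
From mathcomp Require Import all_boot all_order all_algebra.
From mathcomp Require Import all_classical all_reals all_analysis.
From mathcomp Require Import measurable_realfun complex.
From mathcomp Require Import ring lra.

(** The X_i are replaced by the Y_i one at a time (Lindeberg's method), and each
    replacement is controlled by comparing two rank-one updates of one matrix.

    Let B be the matrix built from all vectors but the i-th, Q = (B - z)^-1 and
    rho = R_i^2 / n. Adding rho x x^T to B lowers the trace of the resolvent by
      rho a2 / (1 + rho a1),   with a1 = x^T Q x and a2 = x^T Q^2 x
    ([trace_rank_one]). Everything else follows from the vector y = Q x: as x is
    real and B is real symmetric,
      Im a1 = v |y|^2,   Im (z a1) = v (y^* B y) >= 0,   |a2| <= |y|^2.
    Hence the drop is at most 1 / v in modulus, which gives the bound 2 / v for
    one exchange, and |1 + rho a1| >= v / |z|, which makes the drop a Lipschitz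
    function of (a1, a2) with constant of order rho |z| / v ([trace_drop_diff]).

    Let q1 and q2 be the means of a1 and a2 when Q is held fixed. They depend on
    the law of x only through its covariance, so they are the same for X_i and
    Y_i, and it is enough to bound the mean distance from the drop to
    rho q2 / (1 + rho q1) for each of the two vectors. A real symmetric matrix M
    with |x^T M x| <= c |x|^2 is the difference of the positive semidefinite
    matrices M + c and c, hence deviates in mean by at most 3 c b
    ([mean_deviation]). Applied to the real and imaginary parts of Q and Q^2,
    whose forms are at most |x|^2 / v and |x|^2 / v^2, this yields the constant
    K = 12 ([mean_trace_drop_gap]).

    Since x is independent of the vectors that enter B, Tonelli's theorem reduces
    the random B to a fixed one ([averaged_drop_gap]). The product space is T x T
    itself rather than a space of families of vectors: its two factors carry the
    sub-sigma-algebras generated by the other vectors and by x, and by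
    independence the diagonal map sends P to the product of its restrictions
    ([decoupling_le]). *)

Set Implicit Arguments.
Unset Strict Implicit.
Unset Printing Implicit Defensive.

Import Order.TTheory GRing.Theory Num.Theory.
Import numFieldNormedType.Exports.
Local Open Scope classical_set_scope.
Local Open Scope ring_scope.
Local Notation normc := Normc.normc.
Local Notation Re := complex.Re.
Local Notation Im := complex.Im.
Local Notation toC := (map_mx (real_complex _)).

(** * Real quadratic forms *)

Section RealForms.
Context {R : realType} {p : nat}.
Implicit Types (M N : 'M[R]_p) (x y : 'cV[R]_p).

(** The bilinear form that polarizes [qform M]. *)
Definition bform M x y : R := (x^T *m M *m y) 0 0.

Lemma bformE M x y : bform M x y = \sum_i \sum_j M i j * (x i 0 * y j 0).
Proof.
rewrite /bform mxE exchange_big; apply: eq_bigr => j _ /=.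
rewrite mxE mulr_suml; apply: eq_bigr => i _; rewrite mxE; ring.
Qed.

Lemma qformE M x : qform M x = \sum_i \sum_j M i j * (x i 0 * x j 0).
Proof. exact: bformE. Qed.

Lemma qform1E x : qform 1%:M x = \sum_i x i 0 ^+ 2.
Proof. by rewrite /qform mulmx1 mxE; apply: eq_bigr => i _; rewrite mxE. Qed.

Lemma bformC M x y : M^T = M -> bform M x y = bform M y x.
Proof.
move=> sM; rewrite !bformE exchange_big; apply: eq_bigr => j _.
by apply: eq_bigr => i _; rewrite -[in LHS]sM mxE [y _ _ * _]mulrC.
Qed.

Lemma bform_linl M x y w (a b : R) :
  bform M (a *: x + b *: y) w = a * bform M x w + b * bform M y w.
Proof.
rewrite /bform; have -> : (a *: x + b *: y)^T = a *: x^T + b *: y^T.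
  by rewrite linearP linearZ.
by rewrite !mulmxDl -!scalemxAl mxE [X in X + _]mxE [X in _ + X]mxE.
Qed.

Lemma qform_lin M x y (a b : R) : M^T = M ->
  qform M (a *: x + b *: y) =
  a ^+ 2 * qform M x + 2 * a * b * bform M x y + b ^+ 2 * qform M y.
Proof.
move=> sM; have qE w : qform M w = bform M w w by [].
rewrite !qE bform_linl !(bformC _ (_ + _)) // !bform_linl (bformC y x sM).
by ring.
Qed.

(** Let a and c be the values of the form at x and y, and b the cross term. The
    value at c x - b y is c (a c - b^2), and the one at a y - b x is
    a (a c - b^2); if a = c = 0, the values 2 b and - 2 b at x + y and x - y
    force b = 0. *)
Lemma cauchy_schwarz_form M x y : psd M ->
  bform M x y ^+ 2 <= qform M x * qform M y.
Proof.
move=> [sM M0]; have a0 := M0 x; have c0 := M0 y.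
set a := qform M x in a0 *; set c := qform M y in c0 *; set b := bform M x y.
have H s t : 0 <= s ^+ 2 * a + 2 * s * t * b + t ^+ 2 * c.
  by rewrite -qform_lin.
have [c_gt0|c_le0] := ltP 0 c.
  by rewrite -subr_ge0 -(pmulr_rge0 _ c_gt0); have := H c (- b); congr (0 <= _); ring.
have c_eq0 : c = 0 by apply/eqP; rewrite eq_le c_le0.
have [a_gt0|a_le0] := ltP 0 a.
  by rewrite -subr_ge0 -(pmulr_rge0 _ a_gt0); have := H (- b) a; congr (0 <= _); ring.
have a_eq0 : a = 0 by apply/eqP; rewrite eq_le a_le0.
have := H 1 1; have := H 1 (-1); rewrite a_eq0 c_eq0 => h1 h2.
have -> : b = 0 by lra.
by rewrite mul0r expr0n.
Qed.

Lemma psd1 : psd (1%:M : 'M[R]_p).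
Proof.
by split; [rewrite trmx1|move=> x; rewrite qform1E sumr_ge0// => i _; exact: sqr_ge0].
Qed.

Lemma qformZ (k : R) M x : qform (k *: M) x = k * qform M x.
Proof. by rewrite /qform -scalemxAr -scalemxAl mxE. Qed.

Lemma qformD M N x : qform (M + N) x = qform M x + qform N x.
Proof. by rewrite /qform mulmxDr mulmxDl mxE. Qed.

Lemma psdD M N : psd M -> psd N -> psd (M + N).
Proof.
move=> [sM M0] [sN N0]; split; first by rewrite linearD /= sM sN.
by move=> x; rewrite qformD addr_ge0.
Qed.

Lemma psdZ (k : R) M : 0 <= k -> psd M -> psd (k *: M).
Proof.
move=> k0 [sM M0]; split; first by rewrite linearZ /= sM.
by move=> x; rewrite qformZ mulr_ge0.
Qed.

Lemma psd_outer (x : 'cV[R]_p) : psd (x *m x^T).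
Proof.
split; first by rewrite trmx_mul trmxK.
move=> y; have -> : qform (x *m x^T) y = ((y^T *m x) 0 0) ^+ 2; last exact: sqr_ge0.
rewrite /qform mulmxA -mulmxA mxE big_ord1 expr2; congr (_ * _).
by rewrite -[in LHS](trmxK x) trmxK -[y in LHS]trmxK -trmx_mul mxE.
Qed.

Lemma psd0 : psd (0 : 'M[R]_p).
Proof. by split; [rewrite linear0|move=> x; rewrite /qform mulmx0 mul0mx mxE]. Qed.

Lemma psd_sum (I : Type) (s : seq I) (C : pred I) (F : I -> 'M[R]_p) :
  (forall i, psd (F i)) -> psd (\sum_(i <- s | C i) F i).
Proof. by move=> hF; apply: big_ind => //; [exact: psd0|exact: psdD]. Qed.

Lemma l2normE x : l2norm x = Num.sqrt (qform 1%:M x).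
Proof. by rewrite qform1E. Qed.

(** Cauchy-Schwarz for the form of M, applied to M x and x, bounds |M x|^4 by
    |M x|^2 |x|^2. *)
Lemma op_norm_le1 M : psd M -> (forall x, qform M x <= qform 1%:M x) ->
  op_norm M <= 1.
Proof.
move=> pM M1; apply: ge_sup.
  by exists (l2norm (M *m 0)), 0 => //=; rewrite l2normE qform1E big1 ?sqrtr0//
    => i _; rewrite mxE expr0n.
move=> _ [x /= x1 <-].
have n0 y : 0 <= qform 1%:M y by have [_] := psd1; exact.
apply: le_trans x1; rewrite !l2normE ler_sqrt//.
set y := M *m x.
have By : bform M y x = qform 1%:M y by rewrite /bform /qform mulmx1 -mulmxA.
have := cauchy_schwarz_form y x pM; rewrite By.
have := M1 y; have := M1 x; have := n0 x; have := n0 y; have [_ M0] := pM.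
have := M0 x; have := M0 y.
move: (qform M y) (qform M x) (qform 1%:M y) (qform 1%:M x) => a b c e.
move=> a0 b0 c0 e0 be ac h.
have [c_gt0|] := ltP 0 c; last by move/le_trans; apply.
rewrite -(ler_pM2l c_gt0) -expr2 (le_trans h)//.
by rewrite ler_pM.
Qed.

End RealForms.

(** * Complex numbers *)

Section ComplexNumbers.
Context {R : realType}.
Implicit Types (a b w z : R[i]).

Lemma Re_add a b : Re (a + b) = Re a + Re b. Proof. by case: a b => [? ?] []. Qed.
Lemma Im_add a b : Im (a + b) = Im a + Im b. Proof. by case: a b => [? ?] []. Qed.
Lemma Re_opp a : Re (- a) = - Re a. Proof. by case: a. Qed.
Lemma Im_opp a : Im (- a) = - Im a. Proof. by case: a. Qed.
Lemma Re_mul a b : Re (a * b) = Re a * Re b - Im a * Im b.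
Proof. by case: a b => [? ?] []. Qed.
Lemma Im_mul a b : Im (a * b) = Re a * Im b + Im a * Re b.
Proof. by case: a b => [? ?] []. Qed.

Lemma Re_sum (I : Type) (s : seq I) (Q : pred I) (F : I -> R[i]) :
  Re (\sum_(i <- s | Q i) F i) = \sum_(i <- s | Q i) Re (F i).
Proof. by apply: (big_morph (@complex.Re R) Re_add). Qed.

Lemma Im_sum (I : Type) (s : seq I) (Q : pred I) (F : I -> R[i]) :
  Im (\sum_(i <- s | Q i) F i) = \sum_(i <- s | Q i) Im (F i).
Proof. by apply: (big_morph (@complex.Im R) Im_add). Qed.

Lemma normc_sqrtE w : normc w = Num.sqrt (Re w ^+ 2 + Im w ^+ 2).
Proof. by case: w. Qed.

Lemma normc_ge0 w : 0 <= normc w.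
Proof. by rewrite normc_sqrtE sqrtr_ge0. Qed.

Lemma normc_sqr w : normc w ^+ 2 = Re w ^+ 2 + Im w ^+ 2.
Proof. by rewrite normc_sqrtE sqr_sqrtr// addr_ge0// sqr_ge0. Qed.

Lemma normc_le w (c : R) : 0 <= c -> Re w ^+ 2 + Im w ^+ 2 <= c ^+ 2 -> normc w <= c.
Proof. by move=> c0 h; rewrite -(@ler_pXn2r _ 2) ?nnegrE ?normc_ge0// normc_sqr. Qed.

Lemma normc_real (x : R) : normc (x%:C)%C = `|x|.
Proof. by rewrite /= expr0n addr0 sqrtr_sqr. Qed.

Lemma normr_Re_le w : `|Re w| <= normc w.
Proof. by rewrite -(@ler_pXn2r _ 2) ?nnegrE ?normc_ge0// normc_sqr real_normK ?num_real// lerDl sqr_ge0. Qed.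

Lemma normr_Im_le w : `|Im w| <= normc w.
Proof. by rewrite -(@ler_pXn2r _ 2) ?nnegrE ?normc_ge0// normc_sqr real_normK ?num_real// lerDr sqr_ge0. Qed.

Lemma Im_le_normc w : Im w <= normc w.
Proof. exact: le_trans (ler_norm _) (normr_Im_le w). Qed.

Lemma normc_le_ReIm w : normc w <= `|Re w| + `|Im w|.
Proof.
apply: normc_le; first exact: addr_ge0.
rewrite sqrrD !real_normK ?num_real// lerD2r lerDl mulrn_wge0// mulr_ge0//.
Qed.

Lemma le_normcB a b : normc (a - b) <= normc a + normc b.
Proof. by rewrite (le_trans (le_normcD _ _))// normcN. Qed.

Lemma le_normc_sum (I : Type) (s : seq I) (F : I -> R[i]) :
  normc (\sum_(i <- s) F i) <= \sum_(i <- s) normc (F i).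
Proof.
elim: s => [|i s ih]; first by rewrite !big_nil Normc.normc0.
by rewrite !big_cons (le_trans (le_normcD _ _))// lerD2l.
Qed.

End ComplexNumbers.

(** * The resolvent of a positive semidefinite matrix *)

Section Resolvent.
Context {R : realType} {p : nat}.
Implicit Types (B : 'M[R]_p) (x : 'cV[R]_p) (y : 'cV[R[i]]_p) (z : R[i]).

(** The Hermitian form y^* B y of a real symmetric B, which is the real number
    obtained by summing the forms of the real and imaginary parts of y. *)
Definition hform B y : R := qform B (map_mx (@complex.Re R) y) + qform B (map_mx (@complex.Im R) y).

Definition cdot x y : R[i] := ((toC x)^T *m y) 0 0.

(** The bilinear square y^T y, without conjugation. *)
Definition sdot y : R[i] := (y^T *m y) 0 0.

Definition resolvent B z : 'M[R[i]]_p := invmx (toC B - z%:M).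

Lemma hform_psd B y : psd B -> 0 <= hform B y.
Proof. by move=> [_ B0]; rewrite addr_ge0. Qed.

Lemma hformE B y : B^T = B ->
  ((map_mx conjc y)^T *m toC B *m y) 0 0 = ((hform B y)%:C)%C.
Proof.
move=> sB; rewrite mxE; set a := map_mx (@complex.Re R) y; set b := map_mx (@complex.Im R) y.
have -> : \sum_j ((map_mx conjc y)^T *m toC B) 0 j * y j 0 =
   \sum_i \sum_j Complex (B i j * (a i 0 * a j 0) + B i j * (b i 0 * b j 0))
      (B i j * (a i 0 * b j 0) - B i j * (b i 0 * a j 0)).
  rewrite exchange_big; apply: eq_bigr => j _; rewrite mxE mulr_suml.
  apply: eq_bigr => i _; rewrite !mxE; case: (y i 0) => u v; case: (y j 0) => u' v'.
  by congr Complex; rewrite /=; ring.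
apply/eqP; rewrite eq_complex; apply/andP; split; apply/eqP.
  rewrite Re_sum /= /hform !qformE -big_split; apply: eq_bigr => i _ /=.
  by rewrite Re_sum -big_split.
rewrite Im_sum /= -[RHS](subrr (bform B a b)) {2}(bformC _ _ sB) !bformE.
rewrite -sumrB; apply: eq_bigr => i _ /=.
by rewrite Im_sum -sumrB.
Qed.

Lemma toC1 : toC (1%:M : 'M[R]_p) = 1%:M.
Proof. by rewrite map_mx1. Qed.

Lemma hform1E y : hform 1%:M y = \sum_i normc (y i 0) ^+ 2.
Proof.
rewrite /hform !qform1E -big_split; apply: eq_bigr => i _ /=.
by rewrite normc_sqr !mxE.
Qed.

Lemma hform1_eq0 y : hform 1%:M y = 0 -> y = 0.
Proof.
rewrite hform1E => /eqP; rewrite psumr_eq0; last by move=> *; exact: sqr_ge0.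
move=> /allP x0; apply/matrixP => i j; rewrite ord1 mxE.
have := x0 i (mem_index_enum _); rewrite sqrf_eq0 => /eqP.
exact: Normc.eq0_normc.
Qed.

(** All the bounds on the resolvent are read off the real and imaginary parts of
    this value of y^* x, where x = (B - z) y. *)
Lemma shifted_hform B z x y : B^T = B -> (toC B - z%:M) *m y = toC x ->
  ((map_mx conjc y)^T *m toC x) 0 0 =
    ((hform B y)%:C)%C - z * ((hform 1%:M y)%:C)%C.
Proof.
move=> sB <-; rewrite mulmxBl mulmxBr mxE mulmxA hformE//; congr (_ + _).
rewrite mxE mul_scalar_mx -scalemxAr mxE -hformE ?trmx1//.
by rewrite toC1 mulmx1.
Qed.

(** A kernel vector y would satisfy y^* B y = z |y|^2, with a real left-hand
    side. *)
Lemma shifted_unit B z : B^T = B -> 0 < Im z -> toC B - z%:M \in unitmx.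
Proof.
move=> sB z0; rewrite -unitmx_tr -row_free_unit; apply: inj_row_free => u u0.
have Hy : (toC B - z%:M) *m u^T = toC 0.
  by rewrite -[LHS]trmxK trmx_mul trmxK u0 trmx0 map_mx0.
have := shifted_hform sB Hy; rewrite map_mx0 mulmx0 mxE => /(congr1 (@complex.Im R)).
rewrite Im_add Im_opp Im_mul /= mulr0 !add0r => /eqP; rewrite eq_sym oppr_eq0 mulf_eq0 gt_eqF//=.
by move=> /eqP/hform1_eq0 /(congr1 trmx); rewrite trmxK trmx0.
Qed.

Lemma resolventK B z x : B^T = B -> 0 < Im z ->
  (toC B - z%:M) *m (resolvent B z *m toC x) = toC x.
Proof. by move=> sB z0; rewrite mulmxA mulmxV ?mul1mx// shifted_unit. Qed.

Lemma resolvent_sym B z : B^T = B -> (resolvent B z)^T = resolvent B z.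
Proof.
move=> sB; rewrite /resolvent trmx_inv linearB /= tr_scalar_mx.
by rewrite map_trmx sB.
Qed.

(** Conjugation of [shifted_hform], x being real. *)
Lemma shifted_cdot B z x y : B^T = B -> (toC B - z%:M) *m y = toC x ->
  Im (cdot x y) = Im z * hform 1%:M y /\ Im (z * cdot x y) = Im z * hform B y.
Proof.
move=> sB Hy; have := shifted_hform sB Hy.
have -> : ((map_mx conjc y)^T *m toC x) 0 0 = conjc (cdot x y).
  rewrite /cdot !mxE rmorph_sum; apply: eq_bigr => i _ /=; rewrite !mxE.
  by rewrite rmorphM mulrC; congr (_ * _); rewrite [RHS]conjc_real.
case: (cdot x y) => u w; case: z Hy => a b _ /= [h1 h2].
by split; [lra|nra].
Qed.

Lemma normc_sdot y : normc (sdot y) <= hform 1%:M y.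
Proof.
rewrite /sdot mxE hform1E (le_trans (le_normc_sum _ _))// ler_sum// => i _.
by rewrite mxE Normc.normcM expr2.
Qed.

Lemma normc_cdot x y : normc (cdot x y) ^+ 2 <= qform 1%:M x * hform 1%:M y.
Proof.
rewrite normc_sqr /hform mulrDr.
have -> : Re (cdot x y) = bform 1%:M x (map_mx (@complex.Re R) y).
  rewrite /bform mulmx1 /cdot mxE mxE Re_sum; apply: eq_bigr => i _.
  by rewrite !mxE Re_mul /= mul0r subr0.
have -> : Im (cdot x y) = bform 1%:M x (map_mx (@complex.Im R) y).
  rewrite /bform mulmx1 /cdot mxE mxE Im_sum; apply: eq_bigr => i _.
  by rewrite !mxE Im_mul /= mul0r addr0.
by rewrite lerD// cauchy_schwarz_form//; exact: psd1.
Qed.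

Definition cform (Q : 'M[R[i]]_p) x : R[i] := ((toC x)^T *m Q *m toC x) 0 0.

Lemma cform_cdot Q x : cform Q x = cdot x (Q *m toC x).
Proof. by rewrite /cform /cdot mulmxA. Qed.

Lemma cform_sdot Q x : Q^T = Q -> cform (Q *m Q) x = sdot (Q *m toC x).
Proof. by move=> sQ; rewrite /cform /sdot trmx_mul sQ !mulmxA. Qed.

Section Bounds.
Variables (B : 'M[R]_p) (z : R[i]).
Hypotheses (pB : psd B) (z0 : 0 < Im z).
Let sB : B^T = B. Proof. by case: pB. Qed.
Let Q := resolvent B z.
Let v := Im z.

Lemma Im_cform_resolvent x : v * normc (cform (Q *m Q) x) <= Im (cform Q x).
Proof.
rewrite cform_sdot ?resolvent_sym// cform_cdot.
have [-> _] := shifted_cdot sB (resolventK x sB z0).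
by rewrite ler_pM2l// normc_sdot.
Qed.

Lemma Im_mul_cform_resolvent x : 0 <= Im (z * cform Q x).
Proof.
rewrite cform_cdot; have [_ ->] := shifted_cdot sB (resolventK x sB z0).
by rewrite mulr_ge0 ?(ltW z0)// hform_psd.
Qed.

(** v |y|^2 = Im a1 <= |a1| and |a1|^2 <= |x|^2 |y|^2, with y = Q x. *)
Lemma normc_cform_resolvent x : normc (cform Q x) <= v^-1 * qform 1%:M x.
Proof.
rewrite cform_cdot; set y := Q *m _.
have [ImE _] := shifted_cdot sB (resolventK x sB z0); rewrite -/y in ImE.
have := Im_le_normc (cdot x y); have := normc_cdot x y; rewrite ImE -/y.
have := normc_ge0 (cdot x y); have [_ /(_ x)] := @psd1 R p.
have := hform_psd y (@psd1 R p).
rewrite ler_pdivlMl//; move: (normc _) (hform _ _) (qform _ _) => a h q.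
have v0 : 0 < v by []; rewrite -/v => h0 q0 a0 aq ha.
have [a_gt0|a_le0] := ltP 0 a; last first.
  by apply: le_trans q0; rewrite pmulr_rle0.
rewrite -(ler_pM2l a_gt0) mulrCA -expr2.
apply: (@le_trans _ _ (v * (q * h))); first by rewrite ler_pM2l.
by rewrite mulrCA [a * q]mulrC ler_wpM2l.
Qed.

Lemma normc_cform_resolvent2 x :
  normc (cform (Q *m Q) x) <= (v ^+ 2)^-1 * qform 1%:M x.
Proof.
have h1 := Im_cform_resolvent x; have h2 := Im_le_normc (cform Q x).
have := le_trans (le_trans h1 h2) (normc_cform_resolvent x).
by rewrite -ler_pdivlMl// mulrA -invfM -expr2.
Qed.

(** The imaginary part of z (1 + rho a) is at least that of z. *)
Lemma le_normc_denom (rho : R) (a : R[i]) : 0 <= Im (z * a) -> 0 <= rho ->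
  v <= normc z * normc (1 + (rho%:C)%C * a).
Proof.
move=> h r0; rewrite -Normc.normcM; apply: le_trans (Im_le_normc _).
have -> : z * (1 + (rho%:C)%C * a) = z + (rho%:C)%C * (z * a) by ring.
by rewrite Im_add Im_mul /= mul0r addr0 lerDl mulr_ge0.
Qed.

Lemma denom_neq0 (rho : R) (a : R[i]) : 0 <= Im (z * a) -> 0 <= rho ->
  1 + (rho%:C)%C * a != 0.
Proof.
move=> h r0; apply/eqP => d0; have := le_normc_denom h r0.
by rewrite d0 Normc.normc0 mulr0 leNgt z0.
Qed.

(** The loss of trace of the resolvent under a rank-one update of weight rho;
    [a1] and [a2] stand for the forms of Q and Q^2 at the added vector. *)
Definition trace_drop (rho : R) (a1 a2 : R[i]) : R[i] :=
  (rho%:C)%C * a2 / (1 + (rho%:C)%C * a1).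

(** The Sherman-Morrison identity under the trace. *)
Lemma trace_rank_one rho x : 0 <= rho ->
  \tr (resolvent (B + rho *: (x *m x^T)) z) =
  \tr Q - trace_drop rho (cform Q x) (cform (Q *m Q) x).
Proof.
move=> r0; set S := B + _; set Q' := resolvent S z.
have sS : S^T = S.
  by rewrite /S linearD linearZ /= trmx_mul trmxK sB.
set D := 1 + (rho%:C)%C * cform Q x.
have D0 : D != 0 by rewrite denom_neq0// Im_mul_cform_resolvent.
have BU := shifted_unit sB z0; have SU := shifted_unit sS z0.
have SE : toC S - z%:M = toC B - z%:M + (rho%:C)%C *: (toC x *m (toC x)^T).
  by rewrite /S map_mxD map_mxZ map_mxM -map_trmx addrAC.
have cfE : (toC x)^T *m Q *m toC x = (cform Q x)%:M.
  by rewrite [LHS]mx11_scalar.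
(* (S - z) Q x = (1 + rho a1) x *)
have Q'x : Q' *m toC x = D^-1 *: (Q *m toC x).
  have h : (toC S - z%:M) *m (Q *m toC x) = D *: toC x.
    rewrite SE mulmxDl mulmxA mulmxV// mul1mx -scalemxAl -!mulmxA.
    rewrite [_^T *m _]mulmxA cfE mul_mx_scalar scalerA /D scalerDl scale1r.
    by [].
  rewrite -[Q *m toC x]mul1mx -(mulVmx SU) -mulmxA h -scalemxAr scalerA.
  by rewrite mulVf ?scale1r.
(* (S - z) = (B - z) + rho x x^T, multiplied by Q' on the left and by Q on the
   right *)
have Q'E : Q' = Q - (rho%:C)%C *: (Q' *m toC x *m ((toC x)^T *m Q)).
  apply/esym/eqP; rewrite subr_eq; apply/eqP.
  rewrite -[Q in LHS]mul1mx -(mulVmx SU) SE mulmxDr mulmxDl -!mulmxA mulmxV//.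
  rewrite mulmx1 -SE -/(resolvent _ _) -/Q'; congr (_ + _).
  by rewrite -scalemxAl -scalemxAr -!mulmxA.
rewrite Q'E linearB /= Q'x; congr (_ - _).
rewrite linearZ -scalemxAl linearZ /= mxtrace_mulC.
rewrite /trace_drop -/D -mulrA; congr (_ * _); rewrite mulrC; congr (_ / _).
by rewrite !mulmxA trace_mx11 /cform -!mulmxA.
Qed.

(** |1 + rho a1| >= rho Im a1 >= rho v |a2|. *)
Lemma normc_trace_drop rho x : 0 <= rho ->
  normc (trace_drop rho (cform Q x) (cform (Q *m Q) x)) <= v^-1.
Proof.
move=> r0; rewrite /trace_drop !Normc.normcM Normc.normcV normc_real ger0_norm//.
have D0 := denom_neq0 (Im_mul_cform_resolvent x) r0.
have Dgt0 : 0 < normc (1 + (rho%:C)%C * cform Q x).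
  by rewrite lt_neqAle normc_ge0 andbT eq_sym; apply: contraNneq D0 => /Normc.eq0_normc ->.
rewrite ler_pdivrMr// ler_pdivlMl//; apply: le_trans (Im_le_normc _).
rewrite Im_add Im_mul /= mul0r addr0 add0r mulrCA ler_wpM2l//.
exact: Im_cform_resolvent.
Qed.

(** The difference factors as rho / (1 + rho q1) times
    (a2 - q2) - drop (a1 - q1), where the drop itself is at most 1 / v. *)
Lemma trace_drop_diff rho x (q1 q2 : R[i]) : 0 <= rho -> 0 <= Im (z * q1) ->
  normc (trace_drop rho (cform Q x) (cform (Q *m Q) x) - trace_drop rho q1 q2) <=
  rho * normc z / v * (normc (cform (Q *m Q) x - q2) + v^-1 * normc (cform Q x - q1)).
Proof.
move=> r0 q0; have := normc_trace_drop x r0.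
have D0 := denom_neq0 (Im_mul_cform_resolvent x) r0; have Dq0 := denom_neq0 q0 r0.
set a1 := cform Q x in D0 *; set a2 := cform (Q *m Q) x => dropP.
have -> : trace_drop rho a1 a2 - trace_drop rho q1 q2 =
    (rho%:C)%C / (1 + (rho%:C)%C * q1) *
      ((a2 - q2) - trace_drop rho a1 a2 * (a1 - q1)).
  by rewrite /trace_drop; field; rewrite D0 Dq0.
rewrite Normc.normcM; apply: ler_pM; rewrite ?normc_ge0//.
  rewrite Normc.normcM Normc.normcV normc_real ger0_norm// -!mulrA ler_wpM2l//.
  have Dgt0 : 0 < normc (1 + (rho%:C)%C * q1).
    by rewrite lt_neqAle normc_ge0 andbT eq_sym; apply: contraNneq Dq0 => /Normc.eq0_normc ->.
  rewrite ler_pdivlMr// ler_pdivrMl// mulrC.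
  exact: le_normc_denom.
rewrite (le_trans (le_normcB _ _))// lerD2l Normc.normcM ler_wpM2r// normc_ge0//.
Qed.

End Bounds.
End Resolvent.

(** * Expectations of real functions *)

Section RealExpectation.
Context {d : measure_display} {T : measurableType d} {R : realType}.
Variable P : probability T R.
Implicit Types (f g : T -> R).

(** Real-valued mean, meaningful for functions in [Lfun P 1]. *)
Definition rexp f : R := fine 'E_P[f].

Lemma L1_measurable f : f \in Lfun P 1 -> measurable_fun setT f.
Proof. by move=> /andP[/[!inE]]. Qed.

Lemma L1_cst (c : R) : (fun=> c) \in Lfun P 1.
Proof. exact: Lfun_cst. Qed.

Lemma L1D f g : f \in Lfun P 1 -> g \in Lfun P 1 -> (fun w => f w + g w) \in Lfun P 1.
Proof. by move=> ? ?; rewrite (_ : (fun _ => _) = f + g) ?rpredD. Qed.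

Lemma L1Z (c : R) f : f \in Lfun P 1 -> (fun w => c * f w) \in Lfun P 1.
Proof.
move=> ?; rewrite (_ : (fun _ => _) = c \o* f); first exact: (@Lfun_scale _ _ _ _ f c 1).
by apply/funext => w /=; rewrite mulrC.
Qed.

Lemma L1B f g : f \in Lfun P 1 -> g \in Lfun P 1 -> (fun w => f w - g w) \in Lfun P 1.
Proof. by move=> ? ?; rewrite (_ : (fun _ => _) = f - g) ?rpredB. Qed.

Lemma L1_sum (I : Type) (s : seq I) (h : I -> T -> R) :
  (forall i, h i \in Lfun P 1) -> (fun w => \sum_(i <- s) h i w) \in Lfun P 1.
Proof.
move=> H; elim: s => [|i s ih].
  by under eq_fun do rewrite big_nil; exact: L1_cst.
by under eq_fun do rewrite big_cons; exact: L1D.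
Qed.

Lemma rexp_cst (c : R) : rexp (fun=> c) = c.
Proof. by rewrite /rexp expectation_cst. Qed.

Lemma rexpD f g : f \in Lfun P 1 -> g \in Lfun P 1 ->
  rexp (fun w => f w + g w) = rexp f + rexp g.
Proof.
by move=> hf hg; rewrite /rexp -[LHS]/(fine 'E_P[f \+ g]) expectationD ?fineD ?expectation_fin_num.
Qed.

Lemma rexpZ (c : R) f : f \in Lfun P 1 -> rexp (fun w => c * f w) = c * rexp f.
Proof.
move=> hf; rewrite /rexp (_ : (fun _ => _) = c \o* f).
  by rewrite expectationZl// fineM ?expectation_fin_num.
by apply/funext => w /=; rewrite mulrC.
Qed.

Lemma rexpB f g : f \in Lfun P 1 -> g \in Lfun P 1 ->
  rexp (fun w => f w - g w) = rexp f - rexp g.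
Proof.
by move=> hf hg; rewrite /rexp -[LHS]/(fine 'E_P[f \- g]) expectationB ?fineB ?expectation_fin_num.
Qed.

Lemma rexp_sum (I : Type) (s : seq I) (h : I -> T -> R) :
  (forall i, h i \in Lfun P 1) ->
  rexp (fun w => \sum_(i <- s) h i w) = \sum_(i <- s) rexp (h i).
Proof.
move=> H; elim: s => [|i s ih].
  by under eq_fun do rewrite big_nil; rewrite rexp_cst big_nil.
under eq_fun do rewrite big_cons; rewrite rexpD ?ih ?big_cons//; exact: L1_sum.
Qed.

Lemma rexp_ge0 f : (forall w, 0 <= f w) -> 0 <= rexp f.
Proof. by move=> f0; rewrite /rexp fine_ge0// expectation_ge0. Qed.

Lemma mean_le f g (c : R) : measurable_fun setT f -> measurable_fun setT g ->
  (forall w, 0 <= f w <= g w) -> ('E_P[g] <= c%:E)%E -> ('E_P[f] <= c%:E)%E.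
Proof.
move=> mf mg fg; apply: le_trans; apply: expectation_le => //.
- by move=> w; have /andP[] := fg w.
- by move=> w; have /andP[] := fg w; exact: le_trans.
- by apply: nearW => w; have /andP[] := fg w.
Qed.

Lemma mean_leD f g (a b : R) : measurable_fun setT f -> measurable_fun setT g ->
  (forall w, 0 <= f w) -> (forall w, 0 <= g w) ->
  ('E_P[f] <= a%:E)%E -> ('E_P[g] <= b%:E)%E ->
  ('E_P[fun w => (f w + g w)%R] <= (a + b)%:E)%E.
Proof.
move=> mf mg f0 g0 fa gb; rewrite unlock.
under eq_integral do rewrite EFinD.
rewrite ge0_integralD//; last 4 first.
- by move=> w _; rewrite lee_fin.
- exact/measurable_EFinP.
- by move=> w _; rewrite lee_fin.
- exact/measurable_EFinP.
by rewrite EFinD leeD//; move: fa gb; rewrite unlock.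
Qed.

Lemma mean_leZ (k : R) f (a : R) : measurable_fun setT f ->
  (forall w, 0 <= f w) -> 0 <= k -> ('E_P[f] <= a%:E)%E ->
  ('E_P[fun w => (k * f w)%R] <= (k * a)%:E)%E.
Proof.
move=> mf f0 k0; rewrite unlock => fa.
under eq_integral do rewrite EFinM.
rewrite ge0_integralZl//; [|exact/measurable_EFinP|by move=> w _; rewrite lee_fin].
by rewrite EFinM lee_wpmul2l.
Qed.

End RealExpectation.

(** * Concentration of quadratic forms *)

Section QuadraticForms.
Context {d : measure_display} {T : measurableType d} {R : realType}.
Variables (P : probability T R) (p : nat) (Z : T -> 'cV[R]_p) (b : R).
Hypotheses (Z2 : square_integrable P Z) (Zb : quad_conc_bound P Z b).
Implicit Types (M : 'M[R]_p) (Q : 'M[R[i]]_p).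

Lemma coorM_L1 k l : (fun w => Z w k 0 * Z w l 0) \in Lfun P 1.
Proof. exact: (Lfun2_mul_Lfun1 (Z2 k) (Z2 l)). Qed.

Lemma qform_L1 M : (fun w => qform M (Z w)) \in Lfun P 1.
Proof.
under eq_fun do rewrite qformE.
by apply: L1_sum => i; apply: L1_sum => j; apply: L1Z; exact: coorM_L1.
Qed.

Lemma coor_measurable k : measurable_fun setT (fun w => Z w k 0).
Proof. by have := Z2 k => /andP[/[!inE]]. Qed.

(** For a centered vector the mean of a quadratic form is determined by the
    covariance matrix. *)
Lemma rexp_qform M : mean_vec P Z = 0 ->
  rexp P (fun w => qform M (Z w)) = \sum_i \sum_j M i j * cov_mx P Z i j.
Proof.
move=> Z0; under eq_fun do rewrite qformE.
have hL i j : (fun w => M i j * (Z w i 0 * Z w j 0)) \in Lfun P 1.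
  by apply: L1Z; exact: coorM_L1.
rewrite rexp_sum; last by move=> i; exact: L1_sum.
apply: eq_bigr => i _; rewrite rexp_sum//; apply: eq_bigr => j _.
rewrite rexpZ ?coorM_L1//; congr (_ * _).
have L12 k : coor Z k \in Lfun P 1 by apply: Lfun_subset12 => //; exact: fin_num_measure.
rewrite mxE covarianceE//; last exact: coorM_L1.
have m0 k : fine 'E_P[coor Z k] = 0 by have /matrixP/(_ k 0) := Z0; rewrite !mxE.
have e0 k : 'E_P[coor Z k]%E = 0%E by rewrite -[LHS]fineK ?m0// expectation_fin_num.
by rewrite !e0 mul0e sube0.
Qed.

Definition deviation M w : R := `|qform M (Z w) - rexp P (fun w => qform M (Z w))|.

Lemma deviation_measurable M : measurable_fun setT (deviation M).
Proof.
apply: measurableT_comp; first exact: normr_measurable.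
by apply: L1_measurable; apply: L1B; [exact: qform_L1|exact: L1_cst].
Qed.

(** [quad_conc_bound] is normalized to operator norm 1 and both sides are
    homogeneous in M, so it is applied to M / c. *)
Lemma mean_deviation_psd M (c : R) : 0 < c -> psd M ->
  (forall x, qform M x <= c * qform 1%:M x) ->
  ('E_P[deviation M] <= (c * b)%:E)%E.
Proof.
move=> c0 [sM M0] Mc; pose N := c^-1 *: M.
have pN : psd N.
  split; first by rewrite /N linearZ /= sM.
  by move=> x; rewrite qformZ mulr_ge0// invr_ge0 ltW.
have N1 : op_norm N <= 1.
  by apply: op_norm_le1 => // x; rewrite qformZ ler_pdivrMl.
have -> : deviation M = (fun w => c * deviation N w).
  apply/funext => w; rewrite /deviation -[X in X * _]gtr0_norm// -normrM mulrBr.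
  rewrite -rexpZ ?qform_L1//; congr (`|_ - rexp P _|).
    by rewrite qformZ mulrA mulfV ?mul1r// gt_eqF.
  by apply/funext => w'; rewrite qformZ mulrA mulfV ?mul1r// gt_eqF.
apply: mean_leZ; rewrite ?(ltW c0)//; first exact: deviation_measurable.
  by move=> w; exact: normr_ge0.
exact: Zb.
Qed.

(** M = (M + c) - c, where M + c is positive semidefinite with form at most
    2 c |x|^2; the two parts contribute 2 c b and c b. *)
Lemma mean_deviation M (c : R) : 0 < c -> M^T = M ->
  (forall x, `|qform M x| <= c * qform 1%:M x) ->
  ('E_P[deviation M] <= (3 * c * b)%:E)%E.
Proof.
move=> c0 sM Mc; pose N := M + c *: 1%:M; pose N' := c *: (1%:M : 'M[R]_p).
have [s1 q1] := @psd1 R p.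
have hN : ('E_P[deviation N] <= (2 * c * b)%:E)%E.
  apply: mean_deviation_psd; first by rewrite mulr_gt0.
    split; first by rewrite /N linearD linearZ /= sM s1.
    by move=> x; rewrite qformD qformZ; have := Mc x; rewrite ler_norml; lra.
  by move=> x; rewrite qformD qformZ; have := Mc x; rewrite ler_norml; lra.
have hN' : ('E_P[deviation N'] <= (c * b)%:E)%E.
  apply: mean_deviation_psd => //.
    split; first by rewrite /N' linearZ /= s1.
    by move=> x; rewrite qformZ mulr_ge0// ltW.
  by move=> x; rewrite qformZ.
have -> : 3 * c * b = 2 * c * b + c * b by ring.
apply: (mean_le _ _ _ (mean_leD _ _ _ _ hN hN')); try exact: deviation_measurable;
  try by move=> w; exact: normr_ge0.
- by apply: measurable_funD; exact: deviation_measurable.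
- move=> w; rewrite normr_ge0 /=.
  have -> : M = N - N' by rewrite addrK.
  have qB x : qform (N - N') x = qform N x - qform N' x.
    by rewrite -scaleN1r qformD qformZ mulN1r.
  rewrite /deviation qB; under [X in rexp P X]eq_fun do rewrite qB.
  rewrite rexpB ?qform_L1//.
  set u := qform N _; set u' := qform N' _; set e := rexp _ _; set e' := rexp _ _.
  have -> : u - u' - (e - e') = (u - e) - (u' - e') by ring.
  exact: ler_normB.
Qed.

Definition Remx Q : 'M[R]_p := map_mx (@complex.Re R) Q.
Definition Immx Q : 'M[R]_p := map_mx (@complex.Im R) Q.

Lemma cformE Q x : cform Q x = \sum_i \sum_j Q i j * ((x i 0 * x j 0)%:C)%C.
Proof.
rewrite /cform mxE exchange_big; apply: eq_bigr => j _ /=.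
rewrite mxE mulr_suml; apply: eq_bigr => i _; rewrite !mxE rmorphM /=; ring.
Qed.

Lemma Re_cform Q x : Re (cform Q x) = qform (Remx Q) x.
Proof.
rewrite cformE qformE Re_sum; apply: eq_bigr => i _; rewrite Re_sum.
by apply: eq_bigr => j _; rewrite Re_mul /= !mxE mulr0 subr0.
Qed.

Lemma Im_cform Q x : Im (cform Q x) = qform (Immx Q) x.
Proof.
rewrite cformE qformE Im_sum; apply: eq_bigr => i _; rewrite Im_sum.
by apply: eq_bigr => j _; rewrite Im_mul /= !mxE mulr0 add0r.
Qed.

(** The trace of Q S, that is the mean of x^T Q x for a centered x with
    covariance S. *)
Definition mean_cform Q (S : 'M[R]_p) : R[i] := \sum_i \sum_j Q i j * ((S i j)%:C)%C.

Lemma Re_mean_cform Q : mean_vec P Z = 0 ->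
  Re (mean_cform Q (cov_mx P Z)) = rexp P (fun w => qform (Remx Q) (Z w)).
Proof.
move=> Z0; rewrite rexp_qform// Re_sum; apply: eq_bigr => i _; rewrite Re_sum.
by apply: eq_bigr => j _; rewrite Re_mul /= [in RHS]mxE mulr0 subr0.
Qed.

Lemma Im_mean_cform Q : mean_vec P Z = 0 ->
  Im (mean_cform Q (cov_mx P Z)) = rexp P (fun w => qform (Immx Q) (Z w)).
Proof.
move=> Z0; rewrite rexp_qform// Im_sum; apply: eq_bigr => i _; rewrite Im_sum.
by apply: eq_bigr => j _; rewrite Im_mul /= [in RHS]mxE mulr0 add0r.
Qed.

(** Positivity of Im (z x^T Q x) passes to the mean, so the denominator formed
    with the mean obeys the same lower bound as the random one. *)
Lemma Im_mul_mean_cform_ge0 (z : R[i]) Q : mean_vec P Z = 0 ->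
  (forall x, 0 <= Im (z * cform Q x)) ->
  0 <= Im (z * mean_cform Q (cov_mx P Z)).
Proof.
move=> Z0 zQ; rewrite Im_mul Re_mean_cform// Im_mean_cform// -!rexpZ ?qform_L1//.
rewrite -rexpD; try by apply: L1Z; exact: qform_L1.
by apply: rexp_ge0 => w; have := zQ (Z w); rewrite Im_mul Re_cform Im_cform.
Qed.

(** Real and imaginary parts of Q are real symmetric and their forms are bounded
    by the modulus of the form of Q; each contributes 3 c b. *)
Lemma mean_deviation_complex Q (c : R) : mean_vec P Z = 0 -> 0 < c -> Q^T = Q ->
  (forall x, normc (cform Q x) <= c * qform 1%:M x) ->
  measurable_fun setT (fun w => normc (cform Q (Z w) - mean_cform Q (cov_mx P Z))) ->
  ('E_P[fun w => normc (cform Q (Z w) - mean_cform Q (cov_mx P Z))%R] <= (6 * c * b)%:E)%E.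
Proof.
move=> Z0 c0 sQ Qc mQ.
have hRe : ('E_P[deviation (Remx Q)] <= (3 * c * b)%:E)%E.
  apply: mean_deviation => //; first by rewrite /Remx map_trmx sQ.
  by move=> x; rewrite -Re_cform (le_trans (normr_Re_le _)).
have hIm : ('E_P[deviation (Immx Q)] <= (3 * c * b)%:E)%E.
  apply: mean_deviation => //; first by rewrite /Immx map_trmx sQ.
  by move=> x; rewrite -Im_cform (le_trans (normr_Im_le _)).
have -> : 6 * c * b = 3 * c * b + 3 * c * b by ring.
apply: (mean_le mQ _ _ (mean_leD _ _ _ _ hRe hIm)); try exact: deviation_measurable;
  try by move=> w; exact: normr_ge0.
- by apply: measurable_funD; exact: deviation_measurable.
- move=> w; rewrite normc_ge0 (le_trans (normc_le_ReIm _))//.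
  by rewrite !(Re_add, Im_add, Re_opp, Im_opp) Re_cform Im_cform Re_mean_cform// Im_mean_cform.
Qed.

End QuadraticForms.

(** * Complex-valued random variables *)

Section ComplexMeasurability.
Context {d : measure_display} {T : measurableType d} {R : realType}.
Implicit Types (f : T -> R) (F G : T -> R[i]).

(** Measurability for the Borel sigma-algebra of the complex plane, expressed by
    coordinates. *)
Definition cmeas F : Prop :=
  measurable_fun setT (fun w => Re (F w)) /\ measurable_fun setT (fun w => Im (F w)).

Lemma cmeas_cst (c : R[i]) : cmeas (fun=> c).
Proof. by split; exact: measurable_cst. Qed.

Lemma cmeas_real f : measurable_fun setT f -> cmeas (fun w => ((f w)%:C)%C).
Proof. by move=> mf; split => //=; exact: measurable_cst. Qed.

Lemma cmeasD F G : cmeas F -> cmeas G -> cmeas (fun w => F w + G w).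
Proof.
by move=> [a b] [c e]; split; [under eq_fun do rewrite Re_add|under eq_fun do rewrite Im_add];
  exact: measurable_funD.
Qed.

Lemma cmeasN F : cmeas F -> cmeas (fun w => - F w).
Proof.
by move=> [a b]; split; [under eq_fun do rewrite Re_opp|under eq_fun do rewrite Im_opp];
  exact: measurable_funN.
Qed.

Lemma cmeasB F G : cmeas F -> cmeas G -> cmeas (fun w => F w - G w).
Proof. by move=> mF mG; apply: cmeasD => //; exact: cmeasN. Qed.

Lemma cmeasM F G : cmeas F -> cmeas G -> cmeas (fun w => F w * G w).
Proof.
move=> [a b] [c e]; split.
  by under eq_fun do rewrite Re_mul; apply: measurable_funB; exact: measurable_funM.
by under eq_fun do rewrite Im_mul; apply: measurable_funD; exact: measurable_funM.
Qed.

Lemma cmeas_sum (I : Type) (s : seq I) (h : I -> T -> R[i]) :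
  (forall i, cmeas (h i)) -> cmeas (fun w => \sum_(i <- s) h i w).
Proof.
move=> H; elim: s => [|i s ih].
  by under eq_fun do rewrite big_nil; exact: cmeas_cst.
by under eq_fun do rewrite big_cons; exact: cmeasD.
Qed.

Lemma cmeas_prod (I : Type) (s : seq I) (h : I -> T -> R[i]) :
  (forall i, cmeas (h i)) -> cmeas (fun w => \prod_(i <- s) h i w).
Proof.
move=> H; elim: s => [|i s ih].
  by under eq_fun do rewrite big_nil; exact: cmeas_cst.
by under eq_fun do rewrite big_cons; exact: cmeasM.
Qed.

Lemma sqr_measurable (f g : T -> R) : measurable_fun setT f -> measurable_fun setT g ->
  measurable_fun setT (fun w => f w ^+ 2 + g w ^+ 2).
Proof. by move=> mf mg; apply: measurable_funD; exact: measurable_funX. Qed.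

(** The square root is the real power of exponent 1/2, a measurable function. *)
Lemma normc_measurable F : cmeas F -> measurable_fun setT (fun w => normc (F w)).
Proof.
move=> [a b]; rewrite (_ : (fun _ => _) =
  (fun x : R => x `^ (2^-1)) \o (fun w => Re (F w) ^+ 2 + Im (F w) ^+ 2)).
  by apply: measurableT_comp; [exact: measurable_powR|exact: sqr_measurable].
by apply/funext => w /=; rewrite normc_sqrtE powR12_sqrt// addr_ge0// sqr_ge0.
Qed.

(** The inverse is the conjugate divided by the squared modulus, and inversion
    of nonnegative reals is the real power of exponent -1. *)
Lemma cmeasV F : cmeas F -> cmeas (fun w => (F w)^-1).
Proof.
move=> [a b].
have mV : measurable_fun setT (fun w => (Re (F w) ^+ 2 + Im (F w) ^+ 2)^-1).
  rewrite (_ : (fun _ => _) =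
    (fun x : R => x `^ (-1)) \o (fun w => Re (F w) ^+ 2 + Im (F w) ^+ 2)).
    by apply: measurableT_comp; [exact: measurable_powR|exact: sqr_measurable].
  by apply/funext => w /=; rewrite powR_inv1// addr_ge0// sqr_ge0.
have E w : (F w)^-1 = Complex (Re (F w) * (Re (F w) ^+ 2 + Im (F w) ^+ 2)^-1)
    (- (Im (F w) * (Re (F w) ^+ 2 + Im (F w) ^+ 2)^-1)).
  by case: (F w).
split; under eq_fun do rewrite E /=.
  exact: measurable_funM.
by apply: measurable_funN; exact: measurable_funM.
Qed.

Lemma cmeas_det (p : nat) (M : T -> 'M[R[i]]_p) :
  (forall i j, cmeas (fun w => M w i j)) -> cmeas (fun w => \det (M w)).
Proof.
move=> mM; rewrite /determinant; apply: cmeas_sum => s.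
by apply: cmeasM; [exact: cmeas_cst|exact: cmeas_prod].
Qed.

(** The cofactor formula: the entries are rational functions of the entries of
    the matrix. *)
Lemma cmeas_resolvent (p : nat) (B : T -> 'M[R]_p) (z : R[i]) :
  (forall w, (B w)^T = B w) -> 0 < Im z ->
  (forall i j, measurable_fun setT (fun w => B w i j)) ->
  forall i j, cmeas (fun w => resolvent (B w) z i j).
Proof.
move=> sB z0 mB i j.
have mM k l : cmeas (fun w => (toC (B w) - z%:M) k l).
  by under eq_fun do rewrite !mxE; apply: cmeasD;
    [exact: cmeas_real|exact: cmeas_cst].
under eq_fun => w do rewrite /resolvent /invmx shifted_unit// mxE mxE /cofactor.
apply: cmeasM; first by apply: cmeasV; exact: cmeas_det.
apply: cmeasM; first exact: cmeas_cst.
by apply: cmeas_det => k l; under eq_fun do rewrite mxE mxE.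
Qed.

Lemma cmeas_cform (p : nat) (Q : T -> 'M[R[i]]_p) (x : T -> 'cV[R]_p) :
  (forall i j, cmeas (fun w => Q w i j)) ->
  (forall k, measurable_fun setT (fun w => x w k 0)) ->
  cmeas (fun w => cform (Q w) (x w)).
Proof.
move=> mQ mx; under eq_fun do rewrite cformE.
apply: cmeas_sum => i; apply: cmeas_sum => j; apply: cmeasM => //.
by apply: cmeas_real; exact: measurable_funM.
Qed.

Lemma cmeas_mean_cform (p : nat) (Q : T -> 'M[R[i]]_p) (S : 'M[R]_p) :
  (forall i j, cmeas (fun w => Q w i j)) -> cmeas (fun w => mean_cform (Q w) S).
Proof.
move=> mQ; apply: cmeas_sum => i; apply: cmeas_sum => j.
by apply: cmeasM; [exact: mQ|exact: cmeas_cst].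
Qed.

Lemma cmeas_mulmx (p : nat) (Q Q' : T -> 'M[R[i]]_p) :
  (forall i j, cmeas (fun w => Q w i j)) -> (forall i j, cmeas (fun w => Q' w i j)) ->
  forall i j, cmeas (fun w => (Q w *m Q' w) i j).
Proof.
move=> mQ mQ' i j; under eq_fun do rewrite mxE.
by apply: cmeas_sum => k; exact: cmeasM.
Qed.

Lemma cmeas_trace_drop (rho : R) (a1 a2 : T -> R[i]) : cmeas a1 -> cmeas a2 ->
  cmeas (fun w => trace_drop rho (a1 w) (a2 w)).
Proof.
move=> m1 m2; apply: cmeasM; first by apply: cmeasM => //; exact: cmeas_cst.
apply: cmeasV; apply: cmeasD; first exact: cmeas_cst.
by apply: cmeasM => //; exact: cmeas_cst.
Qed.

End ComplexMeasurability.

Section ComplexExpectation.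
Context {d : measure_display} {T : measurableType d} {R : realType}.
Variable P : probability T R.
Implicit Types (f g : T -> R) (F G : T -> R[i]).

Lemma dominated_L1 f g (c : R) : measurable_fun setT f -> measurable_fun setT g ->
  (forall w, `|f w| <= g w) -> ('E_P[g] <= c%:E)%E -> f \in Lfun P 1.
Proof.
move=> mf mg fg gc; apply/Lfun1_integrable/integrableP; split.
  exact/measurable_EFinP.
apply: le_lt_trans (ltry c); apply: le_trans gc; rewrite unlock.
apply: ge0_le_integral => //=.
- by apply/measurable_EFinP; exact: measurableT_comp.
- by apply/measurable_EFinP.
- by move=> w _; rewrite lee_fin.
Qed.

Lemma rexp_le f g : f \in Lfun P 1 -> g \in Lfun P 1 -> (forall w, f w <= g w) ->
  rexp P f <= rexp P g.
Proof.
move=> f1 g1 fg; rewrite -subr_ge0 -rexpB//.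
by apply: rexp_ge0 => w; rewrite subr_ge0.
Qed.

Lemma Re_L1 F (c : R) : cmeas F -> ('E_P[fun w => normc (F w)%R] <= c%:E)%E ->
  (fun w => Re (F w)) \in Lfun P 1.
Proof.
move=> mF; apply: dominated_L1; [by case: mF|exact: normc_measurable|].
by move=> w; exact: normr_Re_le.
Qed.

Lemma Im_L1 F (c : R) : cmeas F -> ('E_P[fun w => normc (F w)%R] <= c%:E)%E ->
  (fun w => Im (F w)) \in Lfun P 1.
Proof.
move=> mF; apply: dominated_L1; [by case: mF|exact: normc_measurable|].
by move=> w; exact: normr_Im_le.
Qed.

(** Put m = E F. Then |m|^2 = E Re (conj m F) <= |m| E |F|; passing through the
    real and imaginary parts separately would lose a factor in the bound. *)
Lemma normc_expectationC_le F (c : R) : cmeas F ->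
  ('E_P[fun w => normc (F w)%R] <= c%:E)%E -> normc (expectationC P F) <= c.
Proof.
move=> mF Fc; have r1 := Re_L1 mF Fc; have i1 := Im_L1 mF Fc.
have n1 : (fun w => normc (F w)) \in Lfun P 1.
  apply: dominated_L1 Fc => //; try exact: normc_measurable.
  by move=> w; rewrite ger0_norm// normc_ge0.
have nc : rexp P (fun w => normc (F w)) <= c.
  by rewrite -lee_fin /rexp fineK// expectation_fin_num.
have c0 : 0 <= c by apply: le_trans nc; apply: rexp_ge0 => w; exact: normc_ge0.
set m := expectationC P F; have [m0|] := ltP 0 (normc m); last by move/le_trans; apply.
rewrite -(ler_pM2l m0) -expr2 normc_sqr.
have -> : Re m ^+ 2 + Im m ^+ 2 =
    rexp P (fun w => Re m * Re (F w) + Im m * Im (F w)).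
  by rewrite rexpD ?L1Z// !rexpZ// !expr2.
apply: (@le_trans _ _ (rexp P (fun w => normc m * normc (F w)))); last first.
  by rewrite rexpZ// ler_pM2l.
apply: rexp_le; [by apply: L1D; exact: L1Z|exact: L1Z|move=> w].
apply: le_trans (ler_norm _) _.
rewrite -(@ler_pXn2r _ 2) ?nnegrE ?mulr_ge0 ?normc_ge0//.
rewrite exprMn !normc_sqr real_normK ?num_real//.
move: (Re m) (Im m) (Re (F w)) (Im (F w)) => a e x y.
by rewrite -subr_ge0; have := sqr_ge0 (a * y - e * x); congr (0 <= _); ring.
Qed.

Lemma expectationC_sum n (h : 'I_n -> T -> R[i]) :
  (forall k, (fun w => Re (h k w)) \in Lfun P 1) ->
  (forall k, (fun w => Im (h k w)) \in Lfun P 1) ->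
  expectationC P (fun w => \sum_k h k w) = \sum_k expectationC P (h k).
Proof.
move=> hr hi; apply/eqP; rewrite eq_complex Re_sum Im_sum /=; apply/andP.
split; apply/eqP.
  by under eq_fun do rewrite Re_sum; exact: (rexp_sum _ hr).
by under eq_fun do rewrite Im_sum; exact: (rexp_sum _ hi).
Qed.

End ComplexExpectation.

(** * Independence *)

Section Decoupling.
Context {d : measure_display} {T : measurableType d} {R : realType}.
Variables (P : probability T R) (F G : set (set T)).
Hypotheses (mF : F `<=` measurable) (mG : G `<=` measurable).
Hypothesis indep : forall A B, <<s F >> A -> <<s G >> B ->
  P (A `&` B) = (P A * P B)%E.

Local Notation TF := (g_sigma_algebraType F).
Local Notation TG := (g_sigma_algebraType G).

Lemma id_measurable_gsigma (E : set (set T)) : E `<=` measurable ->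
  measurable_fun setT (id : T -> g_sigma_algebraType E).
Proof.
move=> mE _ A mA; rewrite setTI preimage_id.
by apply: (smallest_sub (sigma_algebra_measurable T) mE).
Qed.

(** The law of the diagonal map into the product of T with itself, its factors
    carrying the sigma-algebras of F and G, is the product of the two
    restrictions of P; Tonelli's theorem then bounds the inner integral first. *)
Lemma decoupling_le (h : TF * TG -> \bar R) (c : R) :
  measurable_fun setT h -> (forall u, 0 <= h u)%E ->
  (forall w, \int[P]_w' h (w, w') <= c%:E)%E ->
  (\int[P]_w h (w, w) <= c%:E)%E.
Proof.
move=> mh h0 hc.
have mf := id_measurable_gsigma mF; have mg := id_measurable_gsigma mG.
pose f : {mfun T >-> TF} := HB.pack (id : T -> TF) (isMeasurableFun.Build _ _ _ _ _ mf).
pose g : {mfun T >-> TG} := HB.pack (id : T -> TG) (isMeasurableFun.Build _ _ _ _ _ mg).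
have mD : measurable_fun setT (fun w : T => ((w : TF), (w : TG))).
  exact: (measurable_fun_pair mf mg).
pose D : {mfun T >-> (TF * TG)%type} :=
  HB.pack (fun w : T => ((w : TF), (w : TG))) (isMeasurableFun.Build _ _ _ _ _ mD).
pose PF := distribution P f; pose PG := distribution P g.
have -> : (\int[P]_w h (w, w) = \int[distribution P D]_u h u)%E.
  by rewrite ge0_integral_distribution.
have -> : (\int[distribution P D]_u h u = \int[PF \x PG]_u h u)%E.
  apply: eq_measure_integral => A mA _; apply/esym.
  by apply: (@product_measure_unique _ _ _ _ _ PF PG (distribution P D)).
rewrite fubini_tonelli1// /fubini_F.
apply: (@le_trans _ _ (\int[PF]_w c%:E)%E).
  apply: ge0_le_integral => //.
  - by move=> w _; exact: integral_ge0.
  - exact: measurable_fun_fubini_tonelli_F.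
  - move=> w _; apply: le_trans (hc w); rewrite le_eqVlt; apply/orP; left; apply/eqP.
    rewrite ge0_integral_distribution//.
    exact: measurable_fun_pair2.
by rewrite integral_cst// [X in (_ * X)%E](probability_setT PF) mule1.
Qed.

End Decoupling.

Section Independence.
Context {d : measure_display} {T : measurableType d} {R : realType}.
Variables (P : probability T R) (n p : nat).
Implicit Types (Z : 'I_n -> T -> 'cV[R]_p).

Definition coor_measurable_family Z :=
  forall i k, measurable_fun setT (fun w => Z i w k 0).

Lemma sigma_rvec_measurable (Z : T -> 'cV[R]_p) :
  (forall k, measurable_fun setT (fun w => Z w k 0)) ->
  sigma_rvec Z `<=` measurable.
Proof.
move=> mZ; apply: smallest_sub; first exact: sigma_algebra_measurable.
move=> A; rewrite -bigcup_seq => -[k _ [B mB <-]].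
exact: mZ.
Qed.

Lemma sigma_rvec_coor (Z : T -> 'cV[R]_p) (k : 'I_p) (B : set R) :
  measurable B -> sigma_rvec Z (coor Z k @^-1` B).
Proof.
move=> mB; apply: sub_sigma_algebra; rewrite -bigcup_seq.
by exists k; [exact: mem_index_enum|exists B => //; rewrite setTI].
Qed.

Lemma sigma_rvecT (Z : T -> 'cV[R]_p) : sigma_rvec Z setT.
Proof. exact: (@measurableT _ (g_sigma_algebraType _)). Qed.

Lemma sigma_rvecI (Z : T -> 'cV[R]_p) A B :
  sigma_rvec Z A -> sigma_rvec Z B -> sigma_rvec Z (A `&` B).
Proof. exact: (@measurableI _ (g_sigma_algebraType _)). Qed.

(** Generator of the sigma-algebra of all vectors but the i-th. *)
Definition others Z (i : 'I_n) : set (set T) :=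
  \bigcup_(j in [set` [set~ i]%SET]) sigma_rvec (Z j).

(** A pi-system that generates the same sigma-algebra as [others Z i] and on
    which independence is the product rule. *)
Definition cylinders Z (i : 'I_n) : set (set T) :=
  [set A | exists E : 'I_n -> set T, (forall j, sigma_rvec (Z j) (E j)) /\
    A = \bigcap_(j in [set` [set~ i]%SET]) E j].

Lemma others_sub_cylinders Z i : others Z i `<=` cylinders Z i.
Proof.
move=> A [j /= ji Aj]; exists (fun k => if k == j then A else setT); split.
  by move=> k; case: eqP => [->//|_]; exact: sigma_rvecT.
apply/seteqP; split=> [w Aw k _ /=|w]; first by case: ifP.
by move=> /(_ j ji); rewrite eqxx.
Qed.

Lemma cylinders_setI Z i : setI_closed (cylinders Z i).
Proof.
move=> _ _ [E [hE ->]] [E' [hE' ->]]; exists (fun j => E j `&` E' j); split.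
  by move=> j; exact: sigma_rvecI.
by rewrite bigcapI.
Qed.

Lemma others_measurable Z i : coor_measurable_family Z -> others Z i `<=` measurable.
Proof. by move=> mZ A [j _]; exact: sigma_rvec_measurable. Qed.

(** Both sides come from the product rule, once for all indices and once for the
    indices other than i. *)
Lemma cylinder_indep Z i A B : independent_rvecs P Z ->
  cylinders Z i A -> sigma_rvec (Z i) B -> P (A `&` B) = (P A * P B)%E.
Proof.
move=> iZ [E [hE ->]] hB; pose E' j := if j == i then B else E j.
have -> : \bigcap_(j in [set` [set~ i]%SET]) E j `&` B =
    \bigcap_(j in [set` [set: 'I_n]%SET]) E' j.
  apply/seteqP; split=> [w [Ew Bw] j _|w Ew].
    by rewrite /E'; case: eqVneq => // ji; apply: Ew => /=; rewrite !inE.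
  split.
    by move=> j /=; rewrite !inE => ji; have := Ew j; rewrite /E' (negbTE ji); apply; rewrite /= inE.
  by have := Ew i; rewrite /E' eqxx; apply; rewrite /= inE.
rewrite iZ; last by move=> j _; rewrite /E'; case: eqP => // ->.
rewrite iZ; last by move=> j _.
rewrite (bigD1 i) ?inE//= {1}/E' eqxx muleC; congr (_ * _)%E.
apply: eq_big => j; first by rewrite !inE.
by move=> /andP[_ ji]; rewrite /E' (negbTE ji).
Qed.

(** Two finite measures, A |-> P (A & B) and A |-> P B * P A, agree on a
    pi-system. *)
Lemma others_indep Z i A B : coor_measurable_family Z -> independent_rvecs P Z ->
  <<s others Z i >> A -> sigma_rvec (Z i) B -> P (A `&` B) = (P A * P B)%E.
Proof.
move=> mZ iZ hA hB.
have mB : measurable B by exact: (sigma_rvec_measurable (mZ i)).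
have hA' : <<s cylinders Z i >> A.
  exact: sub_sigma_algebra2 (@others_sub_cylinders Z i) _ hA.
have PBE : P B = (fine (P B))%:E by rewrite fineK// fin_num_measure.
have PB0 : 0 <= fine (P B) by exact: fine_ge0.
have mE C : (P C * P B)%E = mscale (NngNum PB0) P C.
  by rewrite muleC [X in (X * _)%E]PBE.
rewrite mE -[LHS]/(mrestr P mB A).
apply: (g_sigma_algebra_measure_unique (cylinders Z i) _ (fun=> setT)) hA'.
- move=> _ [E [hE ->]]; apply: fin_bigcap_measurable => // j _.
  by apply: (sigma_rvec_measurable (mZ j)).
- move=> _; exists (fun=> setT); split=> [j|]; first exact: sigma_rvecT.
  by rewrite bigcapT.
- by rewrite bigcup_const.
- exact: cylinders_setI.
- move=> C hC; apply: etrans (mE C); exact: cylinder_indep hC hB.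
- by move=> _; rewrite -ge0_fin_numE// fin_num_measure.
Qed.

End Independence.

Section Hybrid.
Context {d : measure_display} {T : measurableType d} {R : realType}.
Variables (P : probability T R) (n p : nat) (X Y : 'I_n -> T -> 'cV[R]_p).

(** The intermediate families of the exchange; independence of the two families
    makes each of them independent. *)
Definition mixed (c : pred 'I_n) : 'I_n -> T -> 'cV[R]_p :=
  fun j => if c j then Y j else X j.

Lemma sigma_rvecs_bigcap (Z : 'I_n -> T -> 'cV[R]_p) (D : set 'I_n) (E : 'I_n -> set T) :
  (forall j, D j -> sigma_rvec (Z j) (E j)) -> sigma_rvecs Z (\bigcap_(j in D) E j).
Proof.
move=> hE.
apply: (@fin_bigcap_measurable _ (g_sigma_algebraType (\bigcup_(i in [set: 'I_n]) sigma_rvec (Z i)))) => // j Dj.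
by apply: sub_sigma_algebra; exists j => //; exact: hE.
Qed.

Lemma mixed_independent (c : pred 'I_n) :
  independent_rvecs P X -> independent_rvecs P Y -> independent_families P X Y ->
  independent_rvecs P (mixed c).
Proof.
move=> iX iY iXY J E hE.
pose J1 := [set j in J | ~~ c j]%SET; pose J2 := [set j in J | c j]%SET.
have -> : \bigcap_(j in [set` J]) E j =
    \bigcap_(j in [set` J1]) E j `&` \bigcap_(j in [set` J2]) E j.
  apply/seteqP; split=> [w h|w [h1 h2] j /= jJ].
    by split=> j /=; rewrite inE => /andP[jJ _]; exact: h.
  case: (boolP (c j)) => cj; first by apply: h2; rewrite /= inE jJ.
  by apply: h1; rewrite /= inE jJ.
have h1 j : j \in J1 -> sigma_rvec (X j) (E j).
  by rewrite inE => /andP[jJ cj]; have := hE j jJ; rewrite /mixed (negbTE cj).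
have h2 j : j \in J2 -> sigma_rvec (Y j) (E j).
  by rewrite inE => /andP[jJ cj]; have := hE j jJ; rewrite /mixed cj.
rewrite iXY; try exact: sigma_rvecs_bigcap.
rewrite iX// iY// [RHS](bigID c) /= muleC; congr (_ * _)%E.
  by apply: eq_bigl => j; rewrite inE.
by apply: eq_bigl => j; rewrite inE.
Qed.

End Hybrid.

(** * Exchanging one vector *)

Section Swap.
Context {d : measure_display} {T : measurableType d} {R : realType}.
Variables (P : probability T R) (n p : nat).
Variables (r : 'I_n -> R) (A : 'M[R]_p) (z : R[i]).
Hypotheses (pA : psd A) (z0 : 0 < Im z).
Let v := Im z.
Implicit Types (Z : 'I_n -> T -> 'cV[R]_p) (B : 'M[R]_p).

(** The matrix whose resolvent is Q: every term of the sample matrix except the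
    i-th. *)
Definition leave_out Z (i : 'I_n) (w : T) : 'M[R]_p :=
  n%:R^-1 *: (\sum_(j < n | j != i) r j ^+ 2 *: (Z j w *m (Z j w)^T)) + A.

Definition weight (i : 'I_n) : R := r i ^+ 2 / n%:R.

Lemma weight_ge0 i : 0 <= weight i.
Proof. by rewrite divr_ge0// sqr_ge0. Qed.

Lemma scatter_leave_out Z i w :
  scatter_mx r (fun j => Z j w) + A =
  leave_out Z i w + weight i *: (Z i w *m (Z i w)^T).
Proof.
rewrite /scatter_mx (bigD1 i)//= scalerDr scalerA /leave_out /weight [_ / _]mulrC.
by rewrite -addrA addrC.
Qed.

Lemma leave_out_psd Z i w : psd (leave_out Z i w).
Proof.
apply: psdD pA; apply: psdZ; first by rewrite invr_ge0.
by apply: psd_sum => j; apply: psdZ; [exact: sqr_ge0|exact: psd_outer].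
Qed.

(** The leave-one-out matrix is evaluated at [w] and the added vector at [w'];
    the diagonal [w = w'] is the drop in the actual sample, while decoupling
    requires the two arguments to vary separately. *)
Definition sample_drop Z (x : T -> 'cV[R]_p) i w w' : R[i] :=
  let Q := resolvent (leave_out Z i w) z in
  trace_drop (weight i) (cform Q (x w')) (cform (Q *m Q) (x w')).

(** The drop with both forms replaced by their means over a centered vector of
    covariance [S]. *)
Definition averaged_drop Z (S : 'M[R]_p) i w : R[i] :=
  let Q := resolvent (leave_out Z i w) z in
  trace_drop (weight i) (mean_cform Q S) (mean_cform (Q *m Q) S).

Lemma mp_sample_drop Z i w :
  mp r A Z z w = p%:R^-1 * (\tr (resolvent (leave_out Z i w) z) - sample_drop Z (Z i) i w w).
Proof.
rewrite /mp (scatter_leave_out Z i) /stieltjes; congr (_ * _).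
exact: (trace_rank_one (leave_out_psd Z i w) z0 (Z i w) (weight_ge0 i)).
Qed.

Lemma leave_out_measurable d' (T' : measurableType d') (u : T' -> T) Z i :
  (forall j k, j != i -> measurable_fun setT (fun w => Z j (u w) k 0)) ->
  forall k l, measurable_fun setT (fun w => leave_out Z i (u w) k l).
Proof.
move=> mZ k l.
have -> : (fun w => leave_out Z i (u w) k l) = (fun w =>
    n%:R^-1 * (\sum_(j < n) if j != i then r j ^+ 2 * (Z j (u w) k 0 * Z j (u w) l 0) else 0) + A k l).
  apply/funext => w; rewrite /leave_out 2!mxE; congr (_ * _ + _).
  rewrite summxE big_mkcond; apply: eq_bigr => j _.
  by case: ifP => // _; rewrite !mxE big_ord1 mxE.
apply: measurable_funD => //; apply: measurable_funM => //.
apply: measurable_sum => j; case: eqVneq => [_|ji]; first exact: measurable_cst.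
by apply: measurable_funM => //; apply: measurable_funM; exact: mZ.
Qed.

Lemma cmeas_leave_out d' (T' : measurableType d') (u : T' -> T) Z i :
  (forall j k, j != i -> measurable_fun setT (fun w => Z j (u w) k 0)) ->
  forall k l, cmeas (fun w => resolvent (leave_out Z i (u w)) z k l).
Proof.
move=> mZ; apply: cmeas_resolvent => //.
  by move=> w; have [] := leave_out_psd Z i (u w).
exact: leave_out_measurable.
Qed.

Lemma cmeas_sample_drop d' (T' : measurableType d') (u u' : T' -> T) Z (x : T -> 'cV[R]_p) i :
  (forall j k, j != i -> measurable_fun setT (fun w => Z j (u w) k 0)) ->
  (forall k, measurable_fun setT (fun w => x (u' w) k 0)) ->
  cmeas (fun w => sample_drop Z x i (u w) (u' w)).
Proof.
move=> mZ mx; have mQ := cmeas_leave_out mZ.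
by apply: cmeas_trace_drop; apply: cmeas_cform => //; exact: cmeas_mulmx.
Qed.

Lemma cmeas_averaged_drop d' (T' : measurableType d') (u : T' -> T) Z S i :
  (forall j k, j != i -> measurable_fun setT (fun w => Z j (u w) k 0)) ->
  cmeas (fun w => averaged_drop Z S i (u w)).
Proof.
move=> mZ; have mQ := cmeas_leave_out mZ.
by apply: cmeas_trace_drop; apply: cmeas_mean_cform => //; exact: cmeas_mulmx.
Qed.

(** Lipschitz bound on the drop combined with the mean deviations 6 b / v of the
    form of Q and 6 b / v^2 of the form of Q^2; each contributes
    6 rho |z| b / v^3. *)
Lemma mean_trace_drop_gap (x : T -> 'cV[R]_p) (b rho : R) B :
  square_integrable P x -> mean_vec P x = 0 -> quad_conc_bound P x b ->
  psd B -> 0 <= rho ->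
  let Q := resolvent B z in let S := cov_mx P x in
  is_true ('E_P[fun w => normc (trace_drop rho (cform Q (x w)) (cform (Q *m Q) (x w)) -
      trace_drop rho (mean_cform Q S) (mean_cform (Q *m Q) S))%R]
   <= (12 * normc z / v ^+ 3 * rho * b)%:E)%E.
Proof.
move=> x2 x0 xb pB rho0 Q S; set q1 := mean_cform Q _; set q2 := mean_cform (Q *m Q) _.
have v0 : 0 < v by [].
have mx := coor_measurable x2.
have mQ i j : cmeas (fun _ : T => Q i j) by exact: cmeas_cst.
have mQQ i j : cmeas (fun _ : T => (Q *m Q) i j) by exact: cmeas_cst.
have mc1 := cmeas_cform mQ mx; have mc2 := cmeas_cform mQQ mx.
have m1 : measurable_fun setT (fun w => normc (cform Q (x w) - q1)).
  by apply: normc_measurable; apply: cmeasB => //; exact: cmeas_cst.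
have m2 : measurable_fun setT (fun w => normc (cform (Q *m Q) (x w) - q2)).
  by apply: normc_measurable; apply: cmeasB => //; exact: cmeas_cst.
have sQ : Q^T = Q by apply: resolvent_sym; case: pB.
have e1 : ('E_P[fun w => normc (cform Q (x w) - q1)%R] <= (6 * v^-1 * b)%:E)%E.
  apply: (mean_deviation_complex x2 xb) => //; first by rewrite invr_gt0.
  by move=> y; exact: normc_cform_resolvent.
have e2 : ('E_P[fun w => normc (cform (Q *m Q) (x w) - q2)%R] <= (6 * (v ^+ 2)^-1 * b)%:E)%E.
  apply: (mean_deviation_complex x2 xb) => //; first by rewrite invr_gt0 exprn_gt0.
    by rewrite trmx_mul sQ.
  by move=> y; exact: normc_cform_resolvent2.
have q0 : 0 <= Im (z * q1).
  by apply: (Im_mul_mean_cform_ge0 x2 x0) => y; exact: Im_mul_cform_resolvent.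
have vi0 : 0 <= v^-1 by rewrite invr_ge0 ltW.
have e3 := mean_leZ m1 (fun w => normc_ge0 _) vi0 e1.
have m3 : measurable_fun setT (fun w => v^-1 * normc (cform Q (x w) - q1)).
  exact: measurable_funM.
have e4 := mean_leD m2 m3 (fun w => normc_ge0 _) (fun w => mulr_ge0 vi0 (normc_ge0 _)) e2 e3.
have k0 : 0 <= rho * normc z / v by rewrite !mulr_ge0// normc_ge0.
have m4 := measurable_funD m2 m3.
have e5 := mean_leZ m4 (fun w => addr_ge0 (normc_ge0 _) (mulr_ge0 vi0 (normc_ge0 _))) k0 e4.
have -> : 12 * normc z / v ^+ 3 * rho * b =
    rho * normc z / v * (6 * (v ^+ 2)^-1 * b + v^-1 * (6 * v^-1 * b)).
  by field; rewrite gt_eqF.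
apply: mean_le e5.
- by apply: normc_measurable; apply: cmeasB; [exact: cmeas_trace_drop|exact: cmeas_cst].
- exact: measurable_funM.
- by move=> w; rewrite normc_ge0 trace_drop_diff.
Qed.

(** Given the other vectors the resolvent is fixed, and [mean_trace_drop_gap]
    bounds the inner mean uniformly. *)
Lemma averaged_drop_gap Z (b : R) i :
  (forall j, square_integrable P (Z j)) -> independent_rvecs P Z ->
  mean_vec P (Z i) = 0 -> quad_conc_bound P (Z i) b ->
  ('E_P[fun w => normc (sample_drop Z (Z i) i w w - averaged_drop Z (cov_mx P (Z i)) i w)%R]
   <= (12 * normc z / v ^+ 3 * weight i * b)%:E)%E.
Proof.
move=> Z2 iZ Z0 Zb; have mZ : coor_measurable_family Z by move=> j; exact: coor_measurable.
rewrite unlock.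
pose h (u : g_sigma_algebraType (others Z i) * g_sigma_algebraType (sigma_rvec (Z i))) : \bar R :=
  (normc (sample_drop Z (Z i) i u.1 u.2 - averaged_drop Z (cov_mx P (Z i)) i u.1))%:E.
apply: (@decoupling_le _ _ _ P (others Z i) (sigma_rvec (Z i)) _ _ _ h).
- exact: others_measurable.
- exact: sigma_rvec_measurable.
- move=> E E' hE hE'; apply: others_indep mZ iZ hE _.
  by rewrite -[sigma_rvec _](@sigma_algebra_id _ setT)//; exact: smallest_sigma_algebra.
- have mo j k : j != i -> measurable_fun setT (fun u :
     g_sigma_algebraType (others Z i) * g_sigma_algebraType (sigma_rvec (Z i)) => Z j u.1 k 0).
    move=> ji; apply: (@measurableT_comp _ _ _ _ _ _ (fun w : g_sigma_algebraType (others Z i) => Z j w k 0)) => //.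
    move=> _ B mB; rewrite setTI; apply: sub_sigma_algebra.
    exists j; first by rewrite /= !inE.
    exact: sigma_rvec_coor.
  have mi k : measurable_fun setT (fun u :
     g_sigma_algebraType (others Z i) * g_sigma_algebraType (sigma_rvec (Z i)) => Z i u.2 k 0).
    apply: (@measurableT_comp _ _ _ _ _ _ (fun w : g_sigma_algebraType (sigma_rvec (Z i)) => Z i w k 0)) => //.
    move=> _ B mB; rewrite setTI; apply: sub_sigma_algebra.
    exact: sigma_rvec_coor.
  apply/measurable_EFinP; apply: normc_measurable; apply: cmeasB.
    exact: cmeas_sample_drop.
  exact: cmeas_averaged_drop.
- by move=> u; rewrite lee_fin normc_ge0.
- move=> w; have := mean_trace_drop_gap (Z2 i) Z0 Zb (leave_out_psd Z i w) (weight_ge0 i).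
  by rewrite unlock.
Qed.

Lemma cmeas_mp Z (i : 'I_n) : (forall j, square_integrable P (Z j)) -> cmeas (mp r A Z z).
Proof.
move=> Z2; have mZ j k : measurable_fun setT (fun w => Z j w k 0).
  exact: coor_measurable (Z2 j) k.
rewrite (_ : mp r A Z z = (fun w => p%:R^-1 *
    (\tr (resolvent (leave_out Z i w) z) - sample_drop Z (Z i) i w w))).
  apply: cmeasM; [exact: cmeas_cst|apply: cmeasB].
    by apply: cmeas_sum => k; exact: (@cmeas_leave_out _ _ id).
  exact: (@cmeas_sample_drop _ _ id id).
by apply/funext => w; rewrite (mp_sample_drop Z i).
Qed.

Lemma eq_leave_out Z Z' i : (forall j, j != i -> Z j = Z' j) ->
  leave_out Z i = leave_out Z' i.
Proof.
move=> ZZ'; apply/funext => w; rewrite /leave_out; congr (_ *: _ + _).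
by apply: eq_bigr => j ji; rewrite ZZ'.
Qed.

(** Both families have the same leave-one-out matrix at i and the same averaged
    drop, so the two traces differ by a difference of drops, each of which is
    close to that common value and at most 1 / v. *)
Lemma mean_mp_swap Z Z' i (b b' : R) :
  (forall j, j != i -> Z j = Z' j) ->
  (forall j, square_integrable P (Z j)) -> (forall j, square_integrable P (Z' j)) ->
  independent_rvecs P Z -> independent_rvecs P Z' ->
  mean_vec P (Z i) = 0 -> mean_vec P (Z' i) = 0 ->
  cov_mx P (Z i) = cov_mx P (Z' i) ->
  quad_conc_bound P (Z i) b -> quad_conc_bound P (Z' i) b' ->
  ('E_P[fun w => normc (mp r A Z z w - mp r A Z' z w)%R] <=
   (p%:R^-1 * Num.min (12 * normc z / v ^+ 3 * weight i * (b + b')) (2 / v))%:E)%E.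
Proof.
move=> ZZ' Z2 Z2' iZ iZ' Z0 Z0' cE Zb Zb'.
have Lo := eq_leave_out ZZ'.
have DE w : mp r A Z z w - mp r A Z' z w =
    (p%:R^-1) * (sample_drop Z' (Z' i) i w w - sample_drop Z (Z i) i w w).
  rewrite (mp_sample_drop Z i) (mp_sample_drop Z' i) Lo -mulrBr; congr (_ * _); ring.
have mZ j k : measurable_fun setT (fun w => Z j w k 0).
  exact: coor_measurable (Z2 j) k.
have mZ' j k : measurable_fun setT (fun w => Z' j w k 0).
  exact: coor_measurable (Z2' j) k.
have mi : cmeas (fun w => sample_drop Z (Z i) i w w) by exact: (@cmeas_sample_drop _ _ id id).
have mi' : cmeas (fun w => sample_drop Z' (Z' i) i w w) by exact: (@cmeas_sample_drop _ _ id id).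
have mm : cmeas (averaged_drop Z (cov_mx P (Z i)) i) by exact: (@cmeas_averaged_drop _ _ id).
have mD := cmeasB mi' mi.
have nE w : normc (mp r A Z z w - mp r A Z' z w) =
    p%:R^-1 * normc (sample_drop Z' (Z' i) i w w - sample_drop Z (Z i) i w w).
  rewrite DE Normc.normcM Normc.normcV; congr (_^-1 * _).
  by rewrite -(rmorph_nat (real_complex R)) normc_real normr_nat.
under [X in 'E_P[X]%E]eq_fun do rewrite nE.
apply: mean_leZ => //; first exact: normc_measurable.
  by move=> w; exact: normc_ge0.
rewrite minEle; case: ifP => _.
  have g1 := averaged_drop_gap Z2 iZ Z0 Zb; have g2 := averaged_drop_gap Z2' iZ' Z0' Zb'.
  have ME : averaged_drop Z' (cov_mx P (Z' i)) i = averaged_drop Z (cov_mx P (Z i)) i.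
    by rewrite /averaged_drop Lo cE.
  rewrite ME in g2; rewrite mulrDr.
  have m1 := normc_measurable (cmeasB mi mm); have m2 := normc_measurable (cmeasB mi' mm).
  apply: (mean_le _ _ _ (mean_leD m1 m2 (fun w => normc_ge0 _) (fun w => normc_ge0 _) g1 g2)).
  - exact: normc_measurable.
  - exact: measurable_funD.
  - move=> w; rewrite normc_ge0 [leRHS]addrC /=.
    set m := averaged_drop _ _ _ w; set a := sample_drop Z' _ _ _ _; set e := sample_drop Z _ _ _ _.
    have -> : a - e = (a - m) - (e - m) by ring.
    exact: le_normcB.
apply: (mean_le _ _ (g := fun=> 2 / v)).
- exact: normc_measurable.
- exact: measurable_cst.
- move=> w; rewrite normc_ge0 /= (le_trans (le_normcB _ _))//.
  have -> : 2 / v = v^-1 + v^-1 by ring.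
  by apply: lerD; apply: (normc_trace_drop (leave_out_psd _ _ _) z0); exact: weight_ge0.
- by rewrite (expectation_cst P (2 / v)).
Qed.

End Swap.

(** * The telescoping argument *)

Theorem theoremA1 (R : realType) :
  exists K : R,
  forall (c C : R) (n p : nat),
  0 < c -> c <= p%:R / n%:R -> p%:R / n%:R <= C ->
  forall (d : measure_display) (T : measurableType d) (P : probability T R)
    (X Y : 'I_n -> T -> 'cV[R]_p) (Sigma : 'I_n -> 'M[R]_p)
    (bX bY : 'I_n -> R),
  (forall i, square_integrable P (X i)) ->
  (forall i, square_integrable P (Y i)) ->
  independent_rvecs P X ->
  independent_rvecs P Y ->
  independent_families P X Y ->
  (forall i, mean_vec P (X i) = 0) ->
  (forall i, mean_vec P (Y i) = 0) ->
  (forall i, cov_mx P (X i) = Sigma i) ->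
  (forall i, cov_mx P (Y i) = Sigma i) ->
  (forall i, quad_conc_bound P (X i) (bX i)) ->
  (forall i, quad_conc_bound P (Y i) (bY i)) ->
  forall (r : 'I_n -> R) (A : 'M[R]_p), psd A ->
  forall z : R[i], 0 < complex.Im z ->
  let v := complex.Im z in
  Normc.normc (expectationC P (fun w => mp r A X z w - mp r A Y z w))
  <= p%:R^-1 *
     \sum_(i < n)
       Num.min (K * Normc.normc z / v ^+ 3 * (r i ^+ 2 / n%:R)
                  * (bX i + bY i))
               (2 / v).
Proof.
exists 12 => _ _ n p _ _ _ d T P X Y Sigma bX bY X2 Y2 iX iY iXY X0 Y0 cX cY bXP bYP r A pA z z0; cbv zeta; set v := Im z.
(* the k-th family takes its first k vectors from Y; exchanging index i leads
   from the i-th family to the next one *)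
pose Z k := mixed X Y (fun j : 'I_n => (j < k)%N).
have Z2 k j : square_integrable P (Z k j) by rewrite /Z /mixed; case: ifP.
have iZ k : independent_rvecs P (Z k) by exact: mixed_independent.
have Zi (i : 'I_n) : Z i i = X i by rewrite /Z /mixed ltnn.
have ZSi (i : 'I_n) : Z i.+1 i = Y i by rewrite /Z /mixed ltnSn.
have ZZ (i j : 'I_n) : j != i -> Z i j = Z i.+1 j.
  by move=> /negbTE ji; rewrite /Z /mixed ltnS [in RHS]leq_eqVlt (inj_eq val_inj) ji.
pose D (i : 'I_n) w := mp r A (Z i) z w - mp r A (Z i.+1) z w.
have mD i : cmeas (D i).
  by apply: cmeasB; apply: (cmeas_mp r pA z0 i (Z2 _)).
have eD (i : 'I_n) := @mean_mp_swap _ _ _ P n p r A z pA z0 (Z i) (Z i.+1) i (bX i) (bY i) (ZZ i)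
  (Z2 _) (Z2 _) (iZ _) (iZ _).
have {}eD (i : 'I_n) : ('E_P[fun w => normc (D i w)%R] <= (p%:R^-1 *
    Num.min (12 * normc z / v ^+ 3 * (r i ^+ 2 / n%:R) * (bX i + bY i)) (2 / v))%:E)%E.
  by apply: eD; rewrite ?Zi ?ZSi ?cX ?cY.
have -> : (fun w => mp r A X z w - mp r A Y z w) = (fun w => \sum_(i < n) D i w).
  apply/funext => w; rewrite /D -(big_mkord xpredT (fun k => mp r A (Z k) z w - mp r A (Z k.+1) z w)).
  under eq_bigr do rewrite -opprB.
  rewrite sumrN telescope_sumr// opprB; congr (mp r A _ z w - mp r A _ z w).
  by apply/funext => j; rewrite /Z /mixed ltn_ord.
rewrite expectationC_sum; last 2 first.
- by move=> i; exact: Re_L1 (mD i) (eD i).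
- by move=> i; exact: Im_L1 (mD i) (eD i).
rewrite mulr_sumr (le_trans (le_normc_sum _ _))// ler_sum// => i _.
exact: normc_expectationC_le.
Qed.
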